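(* Let $R$ be a commutative ring with identity and $S\subseteq R$ a multiplicative set such that $R$ is $S$-Noetherian. Then every $S$-irreducible ideal of $R$ is $S$-primary.
   Context: A multiplicative set $S\subseteq R$ contains $1$ and is closed under multiplication. $R$ is $S$-Noetherian if for each ideal $I$ of $R$ there exist $s\in S$ and a finitely generated ideal $J$ of $R$ with $sI\subseteq J\subseteq I$. An ideal $Q$ of $R$ with $Q\cap S=\emptyset$ is $S$-primary if there exists $s\in S$ such that for all $a,b\in R$ with $ab\in Q$, we have $sa\in Q$ or $sb\in \mathrm{rad}(Q)$, where $\mathrm{rad}(Q)=\{x\in R\mid x^n\in Q \text{ for some } n>0\}$. An ideal $Q$ of $R$ with $Q\cap S=\emptyset$ is $S$-irreducible if whenever $s(I\cap J)\subseteq Q\subseteq I\cap J$ for some $s\in S$ and some ideals $I,J$ of $R$, there exists $s'\in S$ such that $ss'I\subseteq Q$ or $ss'J\subseteq Q$. *)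

(* Defs.v *)
From HB Require Import structures.
From mathcomp Require Import all_boot all_order all_algebra.
From mathcomp Require Import boolp classical_sets cardinality.

Set Implicit Arguments.
Unset Strict Implicit.
Unset Printing Implicit Defensive.

Import GRing.Theory.
Local Open Scope classical_set_scope.
Local Open Scope ring_scope.

(* [comPzRingType] rather than [comNzRingType], so that the zero ring is
   allowed; subsets of R are classical sets, not decidable predicates. *)

Definition multiplicative_set (R : comPzRingType) (S : set R) : Prop :=
  mulr_closed [in S].

(* An ideal is an R-submodule of R. The library's [idealr_closed] is not used
   because it excludes the unit ideal and requires a nonzero ring. *)
Definition is_ideal (R : comPzRingType) (I : set R) : Prop :=
  @submod_closed R R^o [in I].

(* [smallest is_ideal A] is the intersection of all ideals containing A. *)
Definition fg_ideal (R : comPzRingType) (J : set R) : Prop :=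
  exists2 A : set R, finite_set A & J = smallest (@is_ideal R) A.

Definition scale_set (R : comPzRingType) (s : R) (I : set R) : set R :=
  [set s * x | x in I].

Definition radical (R : comPzRingType) (Q : set R) : set R :=
  [set x | exists2 n : nat, (0 < n)%N & Q (x ^+ n)].

Definition S_Noetherian (R : comPzRingType) (S : set R) : Prop :=
  forall I : set R, is_ideal I ->
    exists s : R, exists J : set R,
      [/\ S s, fg_ideal J, scale_set s I `<=` J & J `<=` I].

Definition S_primary (R : comPzRingType) (S Q : set R) : Prop :=
  [/\ is_ideal Q, Q `&` S = set0 &
    exists2 s : R, S s &
      forall a b : R, Q (a * b) -> Q (s * a) \/ radical Q (s * b)].

Definition S_irreducible (R : comPzRingType) (S Q : set R) : Prop :=
  [/\ is_ideal Q, Q `&` S = set0 &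
    forall (s : R) (I J : set R), S s -> is_ideal I -> is_ideal J ->
      scale_set s (I `&` J) `<=` Q -> Q `<=` I `&` J ->
      exists2 s' : R, S s' &
        scale_set (s * s') I `<=` Q \/ scale_set (s * s') J `<=` Q].

(* Main.v *)
(* The colon ideals (Q : t), for t in a multiplicatively closed set T, form a
   directed family, so a finitely generated ideal contained in their union lies
   in one of them. S-Noetherianity therefore gives s in S and t in T with
   s (Q : t') contained in (Q : t) for all t' in T.
   For T = {b, b^2, ...} this gives b^n t' in Q for some t' implies s b^m t' in Q
   with m fixed; when a b is in Q it follows that
   s ((Q + (a)) n (Q + (b^m))) is contained in Q, so S-irreducibility puts an
   S-multiple of a or of b^m in Q. For T = S the same lemma yields a single
   element of S that works for all a and b. *)
Require Import Defs.
From HB Require Import structures.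
From mathcomp Require Import all_boot all_order all_algebra.
From mathcomp Require Import boolp classical_sets cardinality.
From mathcomp Require Import ring.

Set Implicit Arguments.
Unset Strict Implicit.
Unset Printing Implicit Defensive.

Import GRing.Theory.
Local Open Scope classical_set_scope.
Local Open Scope ring_scope.

Lemma is_idealP (R : comPzRingType) (I : set R) :
  is_ideal I <-> I 0 /\ forall r x y : R, I x -> I y -> I (r * x + y).
Proof.
split=> [[I0 IL]|[I0 IL]]; split.
- exact: set_mem I0.
- by move=> r x y Ix Iy; apply: set_mem; apply: IL; exact: mem_set.
- exact: mem_set.
- by move=> r x y /set_mem Ix /set_mem Iy; apply/mem_set/IL.
Qed.

Lemma ideal_add (R : comPzRingType) (I : set R) (x y : R) :
  is_ideal I -> I x -> I y -> I (x + y).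
Proof. by move=> /is_idealP[_ IL] Ix Iy; rewrite -[x]mul1r; exact: IL. Qed.

Lemma ideal_mul (R : comPzRingType) (I : set R) (r x : R) :
  is_ideal I -> I x -> I (r * x).
Proof. by move=> /is_idealP[I0 IL] Ix; rewrite -[r * x]addr0; exact: IL. Qed.

Definition colon (R : comPzRingType) (Q : set R) (t : R) : set R :=
  [set x | Q (t * x)].

Lemma colon_ideal (R : comPzRingType) (Q : set R) (t : R) :
  is_ideal Q -> is_ideal (colon Q t).
Proof.
move=> Qid; have [Q0 QL] := (is_idealP Q).1 Qid.
apply/is_idealP; split=> [|r x y Qx Qy]; rewrite /colon /= ?mulr0//.
by rewrite mulrDr mulrCA; exact: QL.
Qed.

Lemma colon_mull (R : comPzRingType) (Q : set R) (r t : R) :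
  is_ideal Q -> colon Q t `<=` colon Q (r * t).
Proof. by move=> Qid x Qx; rewrite /colon /= -mulrA; exact: ideal_mul. Qed.

Definition ideal_adjoin (R : comPzRingType) (Q : set R) (c : R) : set R :=
  [set x | exists2 q, Q q & exists r, x = q + r * c].

Lemma ideal_adjoin_ideal (R : comPzRingType) (Q : set R) (c : R) :
  is_ideal Q -> is_ideal (ideal_adjoin Q c).
Proof.
move=> /is_idealP[Q0 QL]; apply/is_idealP; split.
  by exists 0 => //; exists 0; rewrite mul0r addr0.
move=> r _ _ [p Qp [u ->]] [q Qq [v ->]].
exists (r * p + q); first exact: QL.
by exists (r * u + v); ring.
Qed.

Lemma sub_ideal_adjoin (R : comPzRingType) (Q : set R) (c : R) :
  Q `<=` ideal_adjoin Q c.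
Proof. by move=> q Qq; exists q => //; exists 0; rewrite mul0r addr0. Qed.

Lemma mem_ideal_adjoin (R : comPzRingType) (Q : set R) (c : R) :
  is_ideal Q -> ideal_adjoin Q c c.
Proof.
by move=> /is_idealP[Q0 _]; exists 0 => //; exists 1; rewrite add0r mul1r.
Qed.

Section ColonUniform.
Variables (R : comPzRingType) (Q T : set R).
Hypotheses (Qid : is_ideal Q) (T_nonempty : T !=set0).
Hypothesis T_mul : forall t u : R, T t -> T u -> T (t * u).

(** Induction on a finite list of generators: at each step [t] is multiplied by an element of [T]
    that serves the new generator, since [colon Q t] and [colon Q u] both lie in
    [colon Q (t * u)]. *)
Lemma fg_ideal_sub_colon (J : set R) :
  fg_ideal J -> J `<=` \bigcup_(t in T) colon Q t ->
  exists2 t, T t & J `<=` colon Q t.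
Proof.
move=> [A /finite_seqP[l ->] ->{J}] JT.
suff [t Tt lt] : exists2 t, T t & [set` l] `<=` colon Q t.
  (* It suffices to contain the generators, because [colon Q t] is itself one of the ideals
     intersected in [smallest]. *)
  by exists t => // x; apply; split=> //; exact: colon_ideal.
have {JT} : [set` l] `<=` \bigcup_(t in T) colon Q t.
  by move=> x lx; apply: JT => I [_]; exact.
elim: l => [_|x l IHl lT]; first by have [t Tt] := T_nonempty; exists t.
have [y ly|t Tt lt] := IHl; first by apply: lT; rewrite /= inE ly orbT.
have [|u Tu Qux] := lT x; first by rewrite /= inE eqxx.
exists (t * u) => [|y]; first exact: T_mul.
rewrite /= inE => /orP[/eqP ->|ly]; first exact: colon_mull.
by rewrite mulrC; apply: colon_mull => //; exact: lt.
Qed.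

Lemma S_Noetherian_colon (S : set R) : S_Noetherian S ->
  exists2 s, S s & exists2 t, T t &
    forall u x, T u -> Q (u * x) -> Q (t * (s * x)).
Proof.
move=> /(_ (\bigcup_(t in T) colon Q t))[].
  apply/is_idealP; split.
    have [t Tt] := T_nonempty; exists t => //.
  by have /is_idealP[] := colon_ideal t Qid.
  (* The union is closed under addition because [x] and [y] both lie in [colon Q (t * u)]. *)
  move=> r x y [t Tt Qx] [u Tu Qy]; exists (t * u); first exact: T_mul.
  have /is_idealP[_] := colon_ideal (t * u) Qid; apply.
    by rewrite mulrC; exact: colon_mull.
  exact: colon_mull.
move=> s [J [Ss Jfg sIJ JI]].
have [t Tt Jt] := fg_ideal_sub_colon Jfg JI.
exists s => //; exists t => // u x Tu Qux.
by apply/Jt/sIJ; exists x => //; exists u.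
Qed.

End ColonUniform.

(** Here [s] and [n] may still depend on [a] and [b]; the dependence of [s] is removed in the
    theorem. *)
Lemma S_irreducible_mul (R : comPzRingType) (S Q : set R) (a b : R) :
  multiplicative_set S -> S_Noetherian S -> S_irreducible S Q -> Q (a * b) ->
  exists2 s, S s & Q (s * a) \/ exists2 n, (0 < n)%N & Q (s * b ^+ n).
Proof.
move=> [_ Smul] Snoeth [Qid _ Qirr] Qab.
(* Exponent 0 is left out because [radical] asks for a positive power. *)
pose T : set R := [set b ^+ n | n in [set n | (0 < n)%N]].
have [||s Ss [_ [n n_gt0 <-] sn]] := S_Noetherian_colon (T := T) Qid _ _ Snoeth.
- by exists b; exists 1%N.
- move=> _ _ [m m_gt0 <-] [k k_gt0 <-]; exists (m + k)%N; last exact: exprD.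
  by rewrite /= addn_gt0 m_gt0.
have [||||s' Ss' ss'Q] := Qirr s (ideal_adjoin Q a) (ideal_adjoin Q (b ^+ n)) Ss.
- exact: ideal_adjoin_ideal.
- exact: ideal_adjoin_ideal.
- move=> _ [x [[p Qp [u xpu]] [q Qq [v xqv]]] <-].
  (* Multiply [x = p + u * a = q + v * b ^+ n] by [b]: the first form puts [b * x] in [Q], and
     subtracting [b * q] leaves this element. *)
  have Qbv : Q (b ^+ n.+1 * v).
    have -> : b ^+ n.+1 * v = b * p + (u * (a * b) + - b * q).
      have -> : b * p + (u * (a * b) + - b * q) = b * (p + u * a) - b * q by ring.
      by rewrite -xpu xqv exprS; ring.
    by do !apply: ideal_add => //; exact: ideal_mul.
  (* By [sn], the exponent [n.+1] in [Qbv] drops to [n] at the cost of a factor [s]. *)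
  have -> : s * x = s * q + b ^+ n * (s * v) by rewrite xqv; ring.
  apply: ideal_add => //; first exact: ideal_mul.
  by apply: (sn (b ^+ n.+1)) => //; exists n.+1.
- by move=> q Qq; split; exact: sub_ideal_adjoin.
exists (s * s'); first by apply/set_mem/Smul; exact: mem_set.
case: ss'Q => ss'Q; [left|right; exists n => //]; apply: ss'Q.
- by exists a => //; exact: mem_ideal_adjoin.
- by exists (b ^+ n) => //; exact: mem_ideal_adjoin.
Qed.

Theorem theorem8 (R : comPzRingType) (S : set R)
    (S_mult : multiplicative_set S) (S_noeth : S_Noetherian S) :
  forall Q : set R, S_irreducible S Q -> S_primary S Q.
Proof.
move=> Q Qirr; have [Qid QS _] := Qirr; have [S1 Smul] := S_mult.
have SM t u : S t -> S u -> S (t * u).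
  by move=> St Su; apply/set_mem/Smul; exact: mem_set.
split=> //.
have [|s Ss [t St st]] := S_Noetherian_colon (T := S) Qid _ SM S_noeth.
  by exists 1; exact: set_mem.
(* Chosen before [a] and [b]: [st] replaces any multiplier [u] in [S] by [t * s]. *)
exists (t * s) => [|a b Qab]; first exact: SM.
have [u Su [Qua|[n n_gt0 Qub]]] := S_irreducible_mul S_mult S_noeth Qirr Qab.
  by left; rewrite -mulrA; exact: st Qua.
right; exists n => //.
(* Only [t * (s * b ^+ n)] is known to lie in [Q]; as [n] is positive, it divides the required
   power. *)
have -> : (t * s * b) ^+ n = (t * s) ^+ n.-1 * (t * (s * b ^+ n)).
  by rewrite exprMn mulrA mulrA -[in LHS](prednK n_gt0) exprSr prednK// !mulrA.
by apply: ideal_mul => //; exact: st Qub.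
Qed.
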